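(* Let $\mathcal H$ be a complex Hilbert space with a dictionary $\mathcal A$, let $\rho\in(0,1]$ and $0<M<\infty$, and let $f\in\mathcal H(\mathcal A,M)$, with a representation $f=\sum_{k}c_kb_k$, $b_k\in\mathcal A$, $\sum_k|c_k|\le M$. Let $g_m$ be the orthogonal standard remainder of $f$ with respect to the Gram-Schmidt orthonormalization $\{B_1,\dots,B_{m-1}\}$ of the elements $\{a_1,\dots,a_{m-1}\}$ consecutively selected under the Pre-Orthogonal $\rho$-Maximal Selection Principle. With $R_m=\max\{r_1,\dots,r_m\}$, where $r_n=\sup_k\{r_n(b_k)\}$, we have $$\|g_m\|\le\frac{R_mM}{\rho}\,\frac1{\sqrt m}.$$
   Context: A dictionary of $\mathcal H$ is a subset $\mathcal A\subset\mathcal H$ with $\|a\|=1$ for all $a\in\mathcal A$ and $\overline{\mathrm{span}}\,\mathcal A=\mathcal H$. The class $\mathcal H(\mathcal A,M)$ is the set of $f\in\mathcal H$ of the form $f=\sum_{k=1}^\infty c_kb_k$ with $b_k\in\mathcal A$ and $\sum_{k=1}^\infty|c_k|\le M$. Given selected $a_1,\dots,a_{k-1}\in\mathcal A$ with Gram-Schmidt orthonormalization $\{B_1,\dots,B_{k-1}\}$, the orthogonal standard remainder is $g_k=f-\sum_{i=1}^{k-1}\langle f,B_i\rangle B_i$ (so $g_1=f$). For $a\in\mathcal A$ not in $\mathrm{span}\{a_1,\dots,a_{k-1}\}$, let $B_k^a$ be the element such that $\{B_1,\dots,B_{k-1},B_k^a\}$ is the Gram-Schmidt orthonormalization of $\{a_1,\dots,a_{k-1},a\}$.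 The sequence is selected under the Pre-Orthogonal $\rho$-Maximal Selection Principle if for each $k$ the element $a_k\in\mathcal A$ (not in $\mathrm{span}\{a_1,\dots,a_{k-1}\}$), with $B_k=B_k^{a_k}$, satisfies $|\langle g_k,B_k\rangle|\ge\rho\sup\{|\langle g_k,B_k^a\rangle| : a\in\mathcal A\}$, the supremum being over those $a\in\mathcal A$ for which $B_k^a$ is defined. For $a\in\mathcal A$, $r_n(a)=\|Q_{\{a_1,\dots,a_{n-1}\}}(a)\|$, where $Q_{\{a_1,\dots,a_{n-1}\}}(a)=a-\sum_{k=1}^{n-1}\langle a,B_k\rangle B_k$ is the orthogonal projection of $a$ onto the orthogonal complement of $\mathrm{span}\{a_1,\dots,a_{n-1}\}$ (so $Q$ is the identity for $n=1$). *)

(* Defs.v *)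
From HB Require Import structures.
From mathcomp Require Import all_boot all_order all_algebra.
From mathcomp Require Import complex.
From mathcomp Require Import all_classical all_reals all_analysis.

Set Implicit Arguments.
Unset Strict Implicit.
Unset Printing Implicit Defensive.

Import Order.TTheory GRing.Theory Num.Theory.
Import numFieldNormedType.Exports.

Local Open Scope classical_set_scope.
Local Open Scope ring_scope.

(* Norms over R[i] take their (real, nonnegative) values in R[i]; [rnorm] is
   the same number in R, where suprema and sums live. *)
Definition rnorm (R : realType) (V : normedZmodType R[i]) (x : V) : R :=
  complex.Re `|x|.

Section Hilbert.
Variables (R : realType) (H : completeNormedModType R[i]).

(* The norm of the complete space H is the one induced by [dot], which is
   linear in its first and conjugate-linear in its second argument. *)
Definition hilbert_norm (dot : {dot H for Num.conj}) : Prop :=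
  forall x : H, `|x| ^+ 2 = dot x x.

Definition lin_span (A : set H) : set H :=
  [set x | exists n (c : 'I_n -> R[i]) (a : 'I_n -> H),
             (forall i, A (a i)) /\ x = \sum_(i < n) c i *: a i].

Definition dictionary (A : set H) : Prop :=
  (forall a, A a -> `|a| = 1) /\ closure (lin_span A) = setT.

Definition representation (A : set H) (M : R) (f : H)
    (c : nat -> R[i]) (b : nat -> H) : Prop :=
  [/\ forall k, A (b k),
      series (fun k => c k *: b k) @ \oo --> f &
      (\sum_(0 <= k <oo) (rnorm (c k))%:E <= M%:E)%E].

Variable dot : {dot H for Num.conj}.

Definition residual (B : seq H) (x : H) : H :=
  x - \sum_(e <- B) dot x e *: e.

Definition gram_schmidt (s : seq H) : seq H :=
  foldl (fun B a => rcons B (`|residual B a|^-1 *: residual B a)) [::] s.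

(* The projection Q_s onto the orthogonal complement of the span of [s]; for
   s = a_1, ..., a_(k-1) it maps f to the orthogonal standard remainder g_k. *)
Definition Qproj (s : seq H) (x : H) : H := residual (gram_schmidt s) x.

(* B_k^a for s = a_1, ..., a_(k-1), meaningful when a is not in the span. *)
Definition gs_next (s : seq H) (a : H) : H := last 0 (gram_schmidt (rcons s a)).

(* Elements of A outside the span of [s], i.e. those with gs_next defined. *)
Definition admissible (A : set H) (s : seq H) : set H :=
  A `\` lin_span [set` s].

(* The supremum is over a nonempty set (it contains the selected element)
   bounded by the norm of the remainder. *)
Definition pre_orthogonal_maximal (A : set H) (rho : R) (f : H)
    (s : seq H) (a : H) : Prop :=
  admissible A s a /\
  rnorm (dot (Qproj s f) (gs_next s a)) >=
    rho * sup [set rnorm (dot (Qproj s f) (gs_next s a')) |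
                 a' in admissible A s].

(* Sequences are indexed from 1; [prefix_before a n] is a_1, ..., a_(n-1). *)
Definition prefix_before (a : nat -> H) (n : nat) : seq H :=
  [seq a i | i <- index_iota 1 n].

(* Only a_1, ..., a_(m-1) are constrained: the selection may stop there. *)
Definition selected_before (A : set H) (rho : R) (f : H) (a : nat -> H)
    (m : nat) : Prop :=
  forall k, (1 <= k < m)%N ->
    pre_orthogonal_maximal A rho f (prefix_before a k) (a k).

Definition remainder (f : H) (a : nat -> H) (m : nat) : H :=
  Qproj (prefix_before a m) f.

Definition rdist (a : nat -> H) (n : nat) (x : H) : R :=
  rnorm (Qproj (prefix_before a n) x).

Definition rdist_sup (a : nat -> H) (b : nat -> H) (n : nat) : R :=
  sup (range (fun k => rdist a n (b k))).

(* The default value 0 is harmless: every r_n is nonnegative. *)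
Definition rdist_max (a : nat -> H) (b : nat -> H) (m : nat) : R :=
  \big[Num.max/0]_(1 <= n < m.+1) rdist_sup a b n.

End Hilbert.

(* Main.v *)
Require Import Defs.
From mathcomp Require Import all_boot all_order all_algebra.
From mathcomp Require Import complex.
From mathcomp Require Import all_classical all_reals all_analysis.
From mathcomp Require Import ring lra.
Import Order.TTheory GRing.Theory Num.Theory.
Import numFieldNormedType.Exports.
Local Open Scope classical_set_scope.
Local Open Scope ring_scope.

(** The remainder satisfies a quadratic recursion, obtained by bounding the
    squared norm of g_k above by a multiple of the coefficient
    d_k = |<g_k, B_k>| that the selection extracts.

    Since g_k is orthogonal to a_1, ..., a_(k-1), we have
    |g_k|^2 = <g_k, f>, and f is an absolutely convergent combination of the
    b_j with total weight at most M, so |g_k|^2 <= M sup_j |<g_k, b_j>|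
    ([rnorm_dot_representation_le]).  Again by orthogonality, <g_k, b_j> only
    sees the part of b_j orthogonal to the span, which is r_k(b_j) times the
    candidate direction B_k^{b_j} ([dot_gs_next]).  If that part vanishes, so
    does <g_k, b_j>; otherwise b_j was a competitor of a_k, and maximality of
    a_k gives |<g_k, b_j>| <= r_k(b_j) d_k / rho.  Hence, with
    L = R_m M / rho, |g_k|^2 <= L d_k ([selection_controls_remainder]).

    On the other hand |g_(k+1)|^2 = |g_k|^2 - d_k^2 ([sqr_remainderS]).
    Eliminating d_k, the numbers x_k = |g_k|^2 satisfy
    L^2 x_(k+1) <= x_k (L^2 - x_k), which together with
    x_1 = |f|^2 <= M^2 <= L^2 forces x_k <= L^2 / k ([quadratic_decay]).

    The two steps above need one invariant, orthonormality of the
    Gram-Schmidt list.  It persists along the selection because no selected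
    element lies in the span of the earlier ones ([selected_orthonormal]), and
    it makes the residual vanish on that span ([Qproj_span]), so that every
    b_j with a nonzero residual is a competitor. *)

Set Implicit Arguments.
Unset Strict Implicit.

(** * Real-valued norms *)

Section RealNorm.
Variables (R : realType) (V : normedZmodType R[i]).

Lemma rnormE (x : V) : `|x| = (rnorm x)%:C%C.
Proof.
have := normr_ge0 x; rewrite lecE /= /rnorm => /andP[/eqP + _].
by case: `|x| => u v /= ->.
Qed.

Lemma rnorm_ge0 (x : V) : 0 <= rnorm x.
Proof. by rewrite -(lecR 0) -rnormE normr_ge0. Qed.

Lemma rnorm_le (x : V) (y : R) : (rnorm x <= y) = (`|x| <= y%:C%C).
Proof. by rewrite rnormE lecR. Qed.

End RealNorm.

(** * Linear spans *)

Section LinearSpan.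
Variables (R : realType) (H : completeNormedModType R[i]).
Implicit Types (A S : set H) (x y : H).

Lemma lin_span_incl A x : A x -> lin_span A x.
Proof.
by move=> Ax; exists 1, (fun=> 1), (fun=> x); split; rewrite // big_ord1 scale1r.
Qed.

Lemma lin_span0 A : lin_span A 0.
Proof. by exists 0, (fun=> 0), (fun=> 0); split=> [[]|]; rewrite ?big_ord0. Qed.

Lemma lin_spanZ A k x : lin_span A x -> lin_span A (k *: x).
Proof.
move=> [n [c [a [Aa ->]]]]; exists n, (fun i => k * c i), a; split=> //.
by rewrite scaler_sumr; apply: eq_bigr => i _; rewrite scalerA.
Qed.

Lemma lin_spanD A x y : lin_span A x -> lin_span A y -> lin_span A (x + y).
Proof.
move=> [n [c [a [Aa ->]]]] [n' [c' [a' [Aa' ->]]]].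
exists (n + n')%N,
  (fun i => match fintype.split i with inl j => c j | inr j => c' j end),
  (fun i => match fintype.split i with inl j => a j | inr j => a' j end).
split=> [i|]; first by case: fintype.split.
rewrite big_split_ord /=; congr (_ + _); apply: eq_bigr => i _.
  by rewrite (unsplitK (inl i)).
by rewrite (unsplitK (inr i)).
Qed.

Lemma lin_spanB A x y : lin_span A x -> lin_span A y -> lin_span A (x - y).
Proof. by move=> Ax Ay; rewrite -scaleN1r; apply/lin_spanD/lin_spanZ. Qed.

Lemma lin_span_sum A (I : Type) (r : seq I) (P : pred I) (F : I -> H) :
  (forall i, P i -> lin_span A (F i)) -> lin_span A (\sum_(i <- r | P i) F i).
Proof.
by move=> AF; apply: big_ind => //; [exact: lin_span0|exact: lin_spanD].
Qed.

Lemma lin_span_subset A S : A `<=` S -> lin_span A `<=` lin_span S.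
Proof.
move=> AS x [n [c [a [Aa ->]]]]; apply: lin_span_sum => i _.
exact/lin_spanZ/lin_span_incl/AS.
Qed.

End LinearSpan.

(** * Orthogonal residuals and Gram-Schmidt *)

Section GramSchmidt.
Variables (R : realType) (H : completeNormedModType R[i]).
Variables (dot : {dot H for Num.conj}) (dotE : hilbert_norm dot).
Implicit Types (B s : seq H) (x y a e : H).

(** The form rules are restated on [dot] itself so that each of them rewrites
    with the same canonical structures on H and R[i] as the others. *)
Lemma dot_conj x y : dot x y = Num.conj (dot y x).
Proof. by rewrite hermC expr0 mul1r. Qed.

Lemma dotC_eq0 x y : dot x y = 0 -> dot y x = 0.
Proof. by move=> xy; rewrite dot_conj xy rmorph0. Qed.

Lemma dotZr k x y : dot x (k *: y) = Num.conj k * dot x y.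
Proof. exact: linearZr_LR. Qed.

Lemma dotZl k x y : dot (k *: x) y = k * dot x y.
Proof. exact: linearZl_LR. Qed.

Lemma dot0r x : dot x 0 = 0. Proof. exact: linear0r. Qed.

Lemma dotDl x y z : dot (x + y) z = dot x z + dot y z.
Proof. exact: linearDl. Qed.

Lemma dotDr x y z : dot x (y + z) = dot x y + dot x z.
Proof. exact: linearDr. Qed.

Lemma dotBl x y z : dot (x - y) z = dot x z - dot y z.
Proof. exact: linearBl. Qed.

Lemma dotBr x y z : dot x (y - z) = dot x y - dot x z.
Proof. exact: linearBr. Qed.

Lemma dot_suml (I : Type) (r : seq I) (F : I -> H) x :
  dot (\sum_(i <- r) F i) x = \sum_(i <- r) dot (F i) x.
Proof. exact: linear_sumlz. Qed.

Lemma dot_sumr (I : Type) (r : seq I) (F : I -> H) x :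
  dot x (\sum_(i <- r) F i) = \sum_(i <- r) dot x (F i).
Proof. exact: linear_sumr. Qed.

Lemma pythagoras x y : dot x y = 0 -> `|x + y| ^+ 2 = `|x| ^+ 2 + `|y| ^+ 2.
Proof. by move=> xy; rewrite !dotE; exact: hnormDd. Qed.

Lemma residual_linear B k x y :
  residual dot B (k *: x + y) = k *: residual dot B x + residual dot B y.
Proof.
rewrite /residual scalerBr addrACA -opprD scaler_sumr -big_split /=.
congr (_ - _); apply: eq_bigr => e _.
by rewrite dotDl dotZl scalerDl scalerA.
Qed.

Lemma residual0 B : residual dot B 0 = 0.
Proof.
rewrite -[X in residual _ _ X](addNr 0) -scaleN1r.
by rewrite residual_linear scaleN1r addNr.
Qed.

Lemma residualZ B k x : residual dot B (k *: x) = k *: residual dot B x.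
Proof. by rewrite -[k *: x]addr0 residual_linear residual0 addr0. Qed.

Lemma residual_sum B (I : Type) (r : seq I) (F : I -> H) :
  residual dot B (\sum_(i <- r) F i) = \sum_(i <- r) residual dot B (F i).
Proof.
elim: r => [|i r IH]; first by rewrite !big_nil residual0.
by rewrite !big_cons -IH -[F i]scale1r residual_linear !scale1r.
Qed.

Lemma residual_rcons B e x :
  residual dot (rcons B e) x = residual dot B x - dot x e *: e.
Proof. by rewrite /residual -cats1 big_cat big_seq1 /= opprD addrA. Qed.

Lemma dot_residual_l B x e : orthonormal dot B -> e \in B ->
  dot (residual dot B x) e = 0.
Proof.
move=> /orthonormalP[Buniq Bdot] eB.
rewrite dotBl dot_suml (bigD1_seq e) //= dotZl (Bdot e e) // eqxx.
rewrite mulr1 big1_seq ?addr0 ?subrr // => e' /andP[e'e e'B].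
by rewrite dotZl (Bdot e' e) // (negbTE e'e) mulr0.
Qed.

(** For y orthogonal to B, subtracting a combination of B from x does not
    change the product with y.  This is used both to replace b_j by its
    projection and to turn |g_k|^2 into <g_k, f>. *)
Lemma dot_residual_r B x y : (forall e, e \in B -> dot y e = 0) ->
  dot y (residual dot B x) = dot y x.
Proof.
move=> yB; rewrite dotBr dot_sumr big1_seq ?subr0 // => e /andP[_ eB].
by rewrite dotZr yB // mulr0.
Qed.

Lemma pythagoras_residual B x : orthonormal dot B ->
  `|x| ^+ 2 = `|residual dot B x| ^+ 2 + `|\sum_(e <- B) dot x e *: e| ^+ 2.
Proof.
move=> Bon; rewrite -pythagoras ?subrK // dot_sumr big1_seq //.
by move=> e /andP[_ eB]; rewrite dotZr dot_residual_l // mulr0.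
Qed.

Lemma norm_residual_le B x : orthonormal dot B -> `|residual dot B x| <= `|x|.
Proof.
move=> Bon; rewrite -(@ler_pXn2r _ 2) ?nnegrE ?normr_ge0 //.
by rewrite (pythagoras_residual x Bon) lerDl exprn_ge0 // normr_ge0.
Qed.

Lemma pythagoras1 x e : `|e| = 1 ->
  `|x - dot x e *: e| ^+ 2 = `|x| ^+ 2 - `|dot x e| ^+ 2.
Proof.
move=> e1.
have eon : orthonormal dot [:: e] by rewrite /orthonormal /= -dotE e1 expr1n eqxx.
rewrite (pythagoras_residual x eon) /residual big_seq1.
by rewrite normrZ e1 mulr1 addrK.
Qed.

(** After normalizing y, the gap in the squared inequality is the squared norm
    of the residual of x, by [pythagoras1]. *)
Lemma cauchy_schwarz x y : `|dot x y| <= `|x| * `|y|.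
Proof.
have [->|y0] := eqVneq y 0; first by rewrite dot0r !normr0 mulr0.
have ny : `|y| != 0 by rewrite normr_eq0.
pose e := `|y|^-1 *: y.
have e1 : `|e| = 1 by rewrite normrZ ger0_norm ?invr_ge0 ?normr_ge0 // mulVf.
have -> : y = `|y| *: e by rewrite scalerA mulfV // scale1r.
rewrite dotZr normrM norm_conjC normrZ e1 mulr1 mulrC.
rewrite ler_pM2r ?normr_id ?normr_gt0 //.
rewrite -(@ler_pXn2r _ 2) ?nnegrE ?normr_ge0 //.
by rewrite -subr_ge0 -pythagoras1 // exprn_ge0 // normr_ge0.
Qed.

Lemma gram_schmidt_rcons s a :
  gram_schmidt dot (rcons s a) = rcons (gram_schmidt dot s) (gs_next dot s a).
Proof.
by rewrite /gs_next /gram_schmidt foldl_rcons last_rcons.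
Qed.

Lemma gs_nextE s a : gs_next dot s a = `|Qproj dot s a|^-1 *: Qproj dot s a.
Proof. by rewrite /gs_next /gram_schmidt foldl_rcons last_rcons. Qed.

Lemma Qproj_rcons s a x :
  Qproj dot (rcons s a) x =
  Qproj dot s x - dot x (gs_next dot s a) *: gs_next dot s a.
Proof. by rewrite /Qproj gram_schmidt_rcons residual_rcons. Qed.

(** Holds for every list: a dependent entry only adds the vector 0, since its
    residual is 0 and is scaled by the inverse of its norm. *)
Lemma gram_schmidt_span s e : e \in gram_schmidt dot s -> lin_span [set` s] e.
Proof.
elim/last_ind: s e => [//|s a IH] e; rewrite gram_schmidt_rcons mem_rcons inE.
have sub : lin_span [set` s] `<=` lin_span [set` rcons s a].
  by apply: lin_span_subset => y /= ys; rewrite mem_rcons inE ys orbT.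
case/predU1P => [->|/IH/sub//]; rewrite gs_nextE; apply: lin_spanZ.
apply: lin_spanB; first by apply: lin_span_incl; rewrite /= mem_rcons mem_head.
rewrite big_seq; apply: lin_span_sum => e' /IH/sub; exact: lin_spanZ.
Qed.

Lemma Qproj0_span s x : Qproj dot s x = 0 -> lin_span [set` s] x.
Proof.
move=> /eqP; rewrite subr_eq0 => /eqP ->.
by rewrite big_seq; apply: lin_span_sum => e /gram_schmidt_span/lin_spanZ.
Qed.

Lemma norm_gs_next s a : Qproj dot s a != 0 -> `|gs_next dot s a| = 1.
Proof.
move=> Qa; rewrite gs_nextE normrZ ger0_norm ?invr_ge0 ?normr_ge0 //.
by rewrite mulVf ?normr_eq0.
Qed.

Lemma orthonormal_rcons s a : orthonormal dot (gram_schmidt dot s) ->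
  Qproj dot s a != 0 -> orthonormal dot (gram_schmidt dot (rcons s a)).
Proof.
move=> Bon Qa; rewrite gram_schmidt_rcons -cats1 orthonormal_cat Bon /=.
apply/andP; split.
  by rewrite /orthonormal /= -dotE norm_gs_next // expr1n eqxx.
apply/allP => e eB /=; rewrite andbT gs_nextE dotZr.
by rewrite (dotC_eq0 (dot_residual_l _ Bon eB)) mulr0.
Qed.

(** For g orthogonal to the processed list, <g, a> only depends on the
    orthogonal part of a, whose length is |Q_s a| and whose direction is the
    next Gram-Schmidt vector.  Both sides are 0 when that part vanishes. *)
Lemma dot_gs_next s g a : (forall e, e \in gram_schmidt dot s -> dot g e = 0) ->
  dot g a = `|Qproj dot s a| * dot g (gs_next dot s a).
Proof.
move=> gB; rewrite -(dot_residual_r a gB) -/(Qproj dot s a).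
have [Q0|Q0] := eqVneq (Qproj dot s a) 0; first by rewrite Q0 dot0r normr0 mul0r.
rewrite gs_nextE dotZr mulrA.
have /CrealP -> : `|Qproj dot s a|^-1 \is Num.real by rewrite realV normr_real.
by rewrite mulfV ?mul1r ?normr_eq0.
Qed.

(** Orthonormality of the output implies that the last step divided by a
    nonzero norm, so the latest entry a is recovered as
    (its projection) + |Q_s a| e, and its residual cancels; earlier entries
    are already killed and are orthogonal to e. *)
Lemma Qproj_mem s x : orthonormal dot (gram_schmidt dot s) -> x \in s ->
  Qproj dot s x = 0.
Proof.
elim/last_ind: s x => [//|s a IH] x.
rewrite gram_schmidt_rcons -cats1 orthonormal_cat => /and3P[Bon e1 Be].
set e := gs_next dot s a in e1 Be *.
have eB y : y \in gram_schmidt dot s -> dot e y = 0.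
  by move=> yB; apply: dotC_eq0; move/allP : Be => /(_ y yB) /=; rewrite andbT => /eqP.
rewrite mem_rcons inE Qproj_rcons -/e => /predU1P[->|xs]; last first.
  rewrite IH // sub0r (dotC_eq0 (x := e)) ?scale0r ?oppr0 //.
  by rewrite (dot_gs_next (s := s)) ?IH ?normr0 ?mul0r.
have ee : dot e e = 1 by move: e1; rewrite /orthonormal /= !andbT => /eqP.
rewrite dot_conj (dot_gs_next (s := s)) // -/e ee mulr1.
have /CrealP -> : `|Qproj dot s a| \is Num.real by rewrite normr_real.
rewrite /e gs_nextE scalerA mulfV ?scale1r ?subrr //.
rewrite normr_eq0; apply/eqP => Q0; move: ee.
by rewrite /e gs_nextE Q0 scaler0 dot0r => /esym/eqP; rewrite oner_eq0.
Qed.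

Lemma Qproj_span s x : orthonormal dot (gram_schmidt dot s) ->
  lin_span [set` s] x -> Qproj dot s x = 0.
Proof.
move=> Bon [n [c [a [sa ->]]]]; rewrite /Qproj residual_sum big1 // => i _.
by rewrite residualZ [residual _ _ _](Qproj_mem Bon) ?scaler0 //; exact: sa.
Qed.

End GramSchmidt.

(** * The quadratic recursion *)

(** In the induction step, k x_k <= K gives
    (k + 1) x_k (K - x_k) <= (K + x_k) (K - x_k) <= K^2. *)
Lemma quadratic_decay (R : realFieldType) (x : nat -> R) (K : R) (m : nat) : 0 < K ->
  (forall k, 0 <= x k) -> x 1%N <= K ->
  (forall k, (0 < k < m)%N -> K * x k.+1 <= x k * (K - x k)) ->
  forall k, (0 < k <= m)%N -> k%:R * x k <= K.
Proof.
move=> K0 x0 x1 xS; elim=> // -[_ _|k IH /= km]; first by rewrite mul1r.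
have {}IH := IH (ltnW km).
have {}xS := xS k.+1 km.
have xk := x0 k.+1.
have k0 : 0 <= k%:R :> R by rewrite ler0n.
have xK : x k.+1 <= K.
  by apply: le_trans IH; rewrite ler_peMl // ler1n.
rewrite -(ler_pM2l K0) -(natr1 k.+1).
set y := x k.+1 in xS IH xk xK *; set z := x k.+2 in xS *.
set n := k.+1%:R in IH *.
have n0 : 0 <= n + 1 :> R by rewrite /n -natr1; lra.
apply: (@le_trans _ _ ((n + 1) * (y * (K - y)))).
  by rewrite mulrCA ler_wpM2l.
apply: (@le_trans _ _ ((K + y) * (K - y))); last by nra.
by rewrite mulrA ler_wpM2r ?subr_ge0 // mulrDl mul1r lerD2r.
Qed.

(** * Remainders under the pre-orthogonal selection *)

Section Greedy.
Variables (R : realType) (H : completeNormedModType R[i]).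
Variables (dot : {dot H for Num.conj}) (dotE : hilbert_norm dot).
Implicit Types (A : set H) (M rho : R) (f g : H) (b : nat -> H) (s : seq H).

Lemma rnorm_cauchy_schwarz x y : rnorm (dot x y) <= rnorm x * rnorm y.
Proof. by rewrite rnorm_le rmorphM /= -!rnormE cauchy_schwarz. Qed.

Lemma rnorm_dot_self x : rnorm (dot x x) = rnorm x ^+ 2.
Proof.
apply: (fmorph_inj (real_complex R)).
by rewrite /= -rnormE rmorphXn /= -rnormE -dotE ger0_norm // exprn_ge0.
Qed.

(** A uniform bound K on the products with the b_k passes to f: every partial
    sum S of the series satisfies |<g, S>| <= K M, and |<g, f - S>| is
    arbitrarily small by Cauchy-Schwarz. *)
Lemma rnorm_dot_representation_le A M f c b g K :
  representation A M f c b -> (forall k, rnorm (dot g (b k)) <= K) ->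
  rnorm (dot g f) <= K * M.
Proof.
move=> [_ fE cM] gK.
have K0 : 0 <= K by apply: le_trans (gK 0%N); exact: rnorm_ge0.
have sumcM n : \sum_(0 <= k < n) rnorm (c k) <= M.
  rewrite -lee_fin; apply: le_trans cM; rewrite -sumEFin.
  by apply: nneseries_lim_ge => k _ _; rewrite lee_fin rnorm_ge0.
have partial n : rnorm (dot g (series (fun k => c k *: b k) n)) <= K * M.
  rewrite rnorm_le /series /= dot_sumr.
  apply: le_trans (ler_norm_sum _ _ _) _.
  apply: (@le_trans _ _ (\sum_(0 <= k < n) (K * rnorm (c k))%:C%C)).
    apply: ler_sum => k _; rewrite dotZr normrM norm_conjC mulrC.
    by rewrite !rnormE -rmorphM /= lecR ler_wpM2r ?rnorm_ge0.
  by rewrite -rmorph_sum /= lecR -mulr_sumr ler_wpM2l.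
apply/ler_addgt0Pr => e e0.
(* The 1 keeps the divisor of the tolerance positive when g = 0. *)
have g1 : 0 < rnorm g + 1 by rewrite ltr_wpDl ?rnorm_ge0.
have e'0 : 0 < (e / (rnorm g + 1))%:C%C :> R[i] by rewrite ltcR divr_gt0.
move/cvgrPdist_lt : fE => /(_ _ e'0) [n _ /(_ n (leqnn n))] /= fn.
set S := series _ n in fn; have {partial} := partial n; rewrite -/S => partial.
have -> : f = S + (f - S) by rewrite addrC subrK.
rewrite rnorm_le dotDr.
apply: le_trans (ler_normD _ _) _.
rewrite !rnormE -rmorphD /= lecR lerD //.
apply: le_trans (rnorm_cauchy_schwarz _ _) _.
move: fn; rewrite rnormE ltcR ltr_pdivlMr // => /ltW; apply: le_trans.
by rewrite mulrC ler_wpM2l ?rnorm_ge0 // lerDl.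
Qed.

Lemma dot_remainder s f : orthonormal dot (gram_schmidt dot s) ->
  rnorm (Qproj dot s f) ^+ 2 = rnorm (dot (Qproj dot s f) f).
Proof.
move=> Bon; rewrite -rnorm_dot_self; congr rnorm.
by apply: dot_residual_r => e; exact: dot_residual_l.
Qed.

(** The maximality of the selected element enters only here: every b_k outside
    the span competes with it, and a b_k inside the span is orthogonal to the
    remainder. *)
Lemma selection_controls_remainder A rho M f c b s a r :
  0 < rho -> representation A M f c b -> 0 <= M ->
  orthonormal dot (gram_schmidt dot s) ->
  pre_orthogonal_maximal dot A rho f s a ->
  (forall k, rnorm (Qproj dot s (b k)) <= r) ->
  rnorm (Qproj dot s f) ^+ 2 <=
    r * M / rho * rnorm (dot (Qproj dot s f) (gs_next dot s a)).
Proof.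
move=> rho0 frep M0 Bon [_ amax] br; set g := Qproj dot s f in amax *.
set d := rnorm (dot g (gs_next dot s a)) in amax *.
rewrite dot_remainder // -/g.
have -> : r * M / rho * d = r * (d / rho) * M by ring.
apply: (rnorm_dot_representation_le frep) => k.
have gB e : e \in gram_schmidt dot s -> dot g e = 0 by exact: dot_residual_l.
rewrite rnorm_le (dot_gs_next _ gB) normrM normr_id.
rewrite !rnormE -rmorphM lecR /=.
have [Q0|Q0] := eqVneq (Qproj dot s (b k)) 0.
  have r0 : 0 <= r by apply: le_trans (br k); exact: rnorm_ge0.
  rewrite {1}/rnorm Q0 normr0 mul0r mulr_ge0 // divr_ge0 ?rnorm_ge0 //; exact: ltW.
apply: ler_pM; rewrite ?rnorm_ge0 //.
rewrite ler_pdivlMr // mulrC; apply: le_trans amax.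
rewrite ler_pM2l //; apply: ub_le_sup.
  (* Cauchy-Schwarz against unit vectors bounds the set of candidates. *)
  exists (rnorm g) => _ /= [a' [_ a'span] <-].
  have Qa' : Qproj dot s a' != 0 by apply/eqP => /Qproj0_span.
  rewrite rnorm_le; apply: le_trans (cauchy_schwarz dotE _ _) _.
  by rewrite norm_gs_next // mulr1 rnormE.
exists (b k) => //; split; first by case: frep.
by move=> /(Qproj_span Bon)/eqP; rewrite (negbTE Q0).
Qed.

Lemma prefix_beforeS (a : nat -> H) k : (0 < k)%N ->
  prefix_before a k.+1 = rcons (prefix_before a k) (a k).
Proof.
case: k => // k _; rewrite /prefix_before /index_iota !subSS !subn0.
by rewrite -[X in iota _ X]addn1 iotaD map_cat cats1.
Qed.

Lemma selected_orthonormal A rho f (a : nat -> H) m k : selected_before dot A rho f a m ->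
  (0 < k <= m)%N -> orthonormal dot (gram_schmidt dot (prefix_before a k)).
Proof.
move=> sel; elim: k => // -[_ _|k IH /= km]; first exact/orthonormalP.
rewrite prefix_beforeS // orthonormal_rcons //; first exact/IH/ltnW.
by have [[_ aspan] _] := sel k.+1 km; apply/eqP => /Qproj0_span.
Qed.

(** The coefficient removed from f at this step equals the one of the current
    remainder, because the new direction is orthogonal to the previous ones. *)
Lemma sqr_remainderS s a f : Qproj dot s a != 0 ->
  orthonormal dot (gram_schmidt dot s) ->
  rnorm (Qproj dot (rcons s a) f) ^+ 2 =
  rnorm (Qproj dot s f) ^+ 2 -
    rnorm (dot (Qproj dot s f) (gs_next dot s a)) ^+ 2.
Proof.
move=> Qa Bon; apply/(fmorph_inj (real_complex R)).
rewrite rmorphB !rmorphXn /= -!rnormE -pythagoras1 ?norm_gs_next //.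
congr (`|_| ^+ 2); rewrite Qproj_rcons; congr (_ - _ *: _).
rewrite /Qproj /residual dotBl dot_suml big1_seq ?subr0 // => e /andP[_ eB].
rewrite dotZl gs_nextE dotZr.
by rewrite (dotC_eq0 (dot_residual_l _ Bon eB)) !mulr0.
Qed.

End Greedy.

Theorem theorem3p3 (R : realType) (H : completeNormedModType R[i])
    (dot : {dot H for Num.conj}) (dotE : hilbert_norm dot)
    (A : set H) (dictA : dictionary A)
    (rho M : R) (rho_bnd : 0 < rho <= 1) (M_gt0 : 0 < M)
    (f : H) (c : nat -> R[i]) (b : nat -> H) (fE : representation A M f c b)
    (m : nat) (m_gt0 : (0 < m)%N) (a : nat -> H)
    (sel : selected_before dot A rho f a m) :
  rnorm (remainder dot f a m) <=
    rdist_max dot a b m * M / rho * (1 / Num.sqrt m%:R).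
Proof.
have /andP[rho0 rho1] := rho_bnd.
have Bon k : (0 < k <= m)%N -> orthonormal dot (gram_schmidt dot (prefix_before a k)).
  exact: selected_orthonormal sel.
have b1 k : rnorm (b k) = 1.
  by have [bA _ _] := fE; rewrite /rnorm dictA.1.
set Rm := rdist_max dot a b m.
have rRm n k : (0 < n <= m)%N -> rdist dot a n (b k) <= Rm.
  move=> nm; apply: (@le_trans _ _ (rdist_sup dot a b n)).
    apply: ub_le_sup; last by exists k.
    exists 1 => _ [j _ <-]; rewrite -(b1 j) /rdist rnorm_le -rnormE.
    exact/norm_residual_le/Bon.
  by rewrite /Rm /rdist_max le_bigmax_seq // mem_index_iota ltnS.
have Q1 x : Qproj dot (prefix_before a 1) x = x.
  by rewrite /Qproj /residual big_nil subr0.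
(* The first distances are the norms r_1(b_k) = 1. *)
have Rm1 : 1 <= Rm by rewrite -(b1 0%N) -{1}[b 0%N]Q1; exact: rRm.
set L := Rm * M / rho.
have ML : M <= L.
  rewrite /L ler_pdivlMr // mulrC ler_pM2r //; exact: le_trans Rm1.
have L0 : 0 < L by exact: lt_le_trans ML.
(* |f|^2 = <f, f> <= |f| M, since each |<f, b_k>| is at most |f|. *)
have fM : rnorm f <= M.
  have [f0|f0] := leP (rnorm f) 0; first exact: le_trans f0 (ltW M_gt0).
  rewrite -(ler_pM2l f0) -expr2 -(rnorm_dot_self dotE).
  apply: (rnorm_dot_representation_le dotE fE) => k.
  by apply: le_trans (rnorm_cauchy_schwarz dotE _ _) _; rewrite b1 mulr1.
pose x k := rnorm (remainder dot f a k) ^+ 2.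
have : m%:R * x m <= L ^+ 2.
  apply: (@quadratic_decay _ x _ m); rewrite ?m_gt0 //=.
  - by rewrite exprn_gt0.
  - by move=> k; rewrite exprn_ge0 // rnorm_ge0.
  - rewrite /x /remainder Q1 ler_pXn2r ?nnegrE ?rnorm_ge0 ?(ltW L0) //.
    exact: le_trans ML.
  move=> k /andP[k0 km].
  have k0m : (0 < k <= m)%N by rewrite k0 ltnW.
  have ksel := sel k (introT andP (conj k0 km)).
  have Qa : Qproj dot (prefix_before a k) (a k) != 0.
    by apply/eqP => /Qproj0_span; case: ksel => -[].
  rewrite /x /remainder prefix_beforeS // (sqr_remainderS dotE) //; last exact: Bon.
  have := selection_controls_remainder dotE rho0 fE (ltW M_gt0) (Bon _ k0m) ksel
    (rRm k ^~ k0m).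
  rewrite -/L; set y := _ ^+ 2; set d := rnorm _ => yLd.
  have y0 : 0 <= y by rewrite exprn_ge0 // rnorm_ge0.
  (* L^2 (y - d^2) <= y (L^2 - y) is y^2 <= (L d)^2 rearranged. *)
  have : y ^+ 2 <= (L * d) ^+ 2 by rewrite ler_sqr ?nnegrE // (le_trans y0).
  by nra.
move=> mx; rewrite mul1r ler_pdivlMr ?sqrtr_gt0 ?ltr0n // mulrC.
move: mx; rewrite -{1}(sqr_sqrtr (ler0n R m)) -exprMn.
by rewrite ler_sqr ?nnegrE ?(ltW L0) ?mulr_ge0 ?sqrtr_ge0 ?rnorm_ge0.
Qed.
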